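(* (a) If $f\in\mathcal A_c(\mathbb R^2)$ then $f$ has a unique primitive in $\mathcal B_c(\overline{\mathbb R}^2)$, i.e. there is exactly one $F\in\mathcal B_c(\overline{\mathbb R}^2)$ with $f=\partial_{12}F$. (b) For $f\in\mathcal A_c(\mathbb R^2)$ with primitive $F\in\mathcal B_c(\overline{\mathbb R}^2)$ define the Alexiewicz norm of $f$ by $\lVert f\rVert=\lVert F\rVert_\infty$. Then $\mathcal A_c(\mathbb R^2)$ is a Banach space under this norm, and the derivative $\partial_{12}$ provides a linear isometry and isomorphism between $\mathcal B_c(\overline{\mathbb R}^2)$ and $\mathcal A_c(\mathbb R^2)$. (c) If $G$ is continuous on $\overline{\mathbb R}^2$ then $\partial_{12}G\in\mathcal A_c(\mathbb R^2)$. (d) For all $f,g\in\mathcal A_c(\mathbb R^2)$, $c_1,c_2\in\mathbb R$ and $\phi\in\mathcal D(\mathbb R^2)$ we have $\langle c_1f+c_2g,\phi\rangle=c_1\langle f,\phi\rangle+c_2\langle g,\phi\rangle$.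
   Context: $\overline{\mathbb R}=[-\infty,\infty]$ is the two-point compactification of $\mathbb R$ (order topology), and $\overline{\mathbb R}^2$ carries the product topology. $C(\overline{\mathbb R}^2)$ is the set of continuous real-valued functions on $\overline{\mathbb R}^2$. $\mathcal B_c(\overline{\mathbb R}^2)=\{F\in C(\overline{\mathbb R}^2)\mid F(-\infty,s)=F(s,-\infty)=0 \text{ for all } s\in\overline{\mathbb R}\}$, a Banach space under the uniform norm $\lVert\cdot\rVert_\infty$ with pointwise operations. $\mathcal D(\mathbb R^2)=C_c^\infty(\mathbb R^2)$ and $\mathcal D'(\mathbb R^2)$ is the space of distributions on $\mathbb R^2$. $\partial_{12}=\partial_1\partial_2$ is the distributional derivative; for $F\in C(\overline{\mathbb R}^2)$, $\langle\partial_{12}F,\phi\rangle=\int_{-\infty}^\infty\int_{-\infty}^\infty F(x,y)\,\partial_{12}\phi(x,y)\,dy\,dx$. $\mathcal A_c(\mathbb R^2)=\{f\in\mathcal D'(\mathbb R^2)\mid f=\partial_{12}F\text{ for some }F\in\mathcal B_c(\overline{\mathbb R}^2)\}$; such an $F$ is called a primitive of $f$. *)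

(* Defs.v *)
From HB Require Import structures.
From mathcomp Require Import all_boot all_order all_algebra.
From mathcomp Require Import all_classical all_reals all_analysis.

Set Implicit Arguments.
Unset Strict Implicit.
Unset Printing Implicit Defensive.

Import Order.TTheory GRing.Theory Num.Theory.
Import numFieldNormedType.Exports.

Local Open Scope classical_set_scope.
Local Open Scope ring_scope.

Section test_functions.
Context {R : realType}.
Implicit Types phi psi : (R * R)%type -> R.

Definition basis_vec (i : 'I_2) : (R * R)%type :=
  if i == ord0 then (1, 0) else (0, 1).

Definition partial (i : 'I_2) phi : (R * R)%type -> R :=
  fun p => 'D_(basis_vec i) phi p.

(* [partials [:: i1; ...; ik] phi] is d_i1 (... (d_ik phi)). *)
Definition partials (s : seq 'I_2) phi : (R * R)%type -> R :=
  foldr partial phi s.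

Definition smooth phi := forall s : seq 'I_2,
  continuous (partials s phi) /\
  forall i p, derivable (partials s phi) p (basis_vec i).

Definition tsupport phi : set (R * R)%type := closure [set p | phi p != 0].

Definition test_pred : {pred (R * R)%type -> R} :=
  mem [set phi | smooth phi /\ compact (tsupport phi)].

Lemma partials_lin s a phi psi : smooth phi -> smooth psi ->
  partials s (a *: phi + psi) = a *: partials s phi + partials s psi.
Proof.
move=> sp sq; elim: s => [//|i s IH] /=.
rewrite IH; apply/funext => p; rewrite /partial.
have /(_ i p) dp := (sp s).2; have /(_ i p) dq := (sq s).2.
by rewrite deriveD ?deriveZ//; exact: derivableZ.
Qed.

Lemma smooth_lin a phi psi : smooth phi -> smooth psi -> smooth (a *: phi + psi).
Proof.
move=> sp sq s; rewrite partials_lin//; split=> [p|i p].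
  apply: (@continuousD _ _ _ (a *: partials s phi)); last exact: (sq s).1.
  by apply: continuousZl_tmp; exact: (sp s).1.
apply: derivableD; last exact: (sq s).2.
by apply: derivableZ; exact: (sp s).2.
Qed.

Lemma smooth0 : smooth 0.
Proof.
have p0 s : partials s 0 = 0.
  elim: s => [//|i s IH] /=; rewrite IH.
  by apply/funext => p; rewrite /partial derive_cst.
move=> s; rewrite p0; split=> [p|i p]; [exact: cst_continuous|exact: derivable_cst].
Qed.

Fact test_pred_submod : GRing.submod_closed test_pred.
Proof.
split=> [|a phi psi]; rewrite !inE.
  split; first exact: smooth0.
  rewrite (_ : tsupport _ = set0); first exact: compact0.
  rewrite /tsupport (_ : [set p | _] = set0) ?closure0//.
  by apply/seteqP; split=> p //=; rewrite eqxx.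
move=> [sp cp] [sq cq]; split; first exact: smooth_lin.
apply: (subclosed_compact _ (compactU cp cq)); first exact: closed_closure.
rewrite /tsupport -closureU; apply: closureS => p /= h.
have [p0|] := eqVneq (phi p) 0; last by left.
right; apply: contra h => /eqP q0.
by rewrite addrfctE /= q0 addr0 scalrfctE p0 scaler0.
Qed.

HB.instance Definition _ :=
  GRing.isSubmodClosed.Build R ((R * R)%type -> R) test_pred test_pred_submod.

End test_functions.

(* The space D(R^2); its vector space operations are pointwise. *)
Record testfun (R : realType) := TestFun {
  testfun_val :> (R * R)%type -> R;
  testfun_valP : testfun_val \in test_pred }.

HB.instance Definition _ (R : realType) := [isSub for @testfun_val R].
HB.instance Definition _ (R : realType) := [Choice of testfun R by <:].
HB.instance Definition _ (R : realType) :=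
  [SubChoice_isSubLmodule of testfun R by <:].

Section distributions.
Context {R : realType}.

Definition test_cvg (phi_ : nat -> testfun R) (phi : testfun R) : Prop :=
  (exists2 K : set (R * R)%type, compact K & forall n, tsupport (phi_ n) `<=` K)
  /\ forall s : seq 'I_2,
       {uniform, (fun n => partials s (phi_ n)) @ \oo --> partials s phi}.

(* The space D'(R^2), as a set of functionals on D(R^2). For linear functionals
   on D(R^2), continuity and sequential continuity coincide. *)
Definition schwartz_distribution : set (testfun R -> R) :=
  [set T | scalar T /\
    forall phi_ phi, test_cvg phi_ phi -> (T (phi_ n) @[n --> \oo] --> T phi)].

(* Library topology: [\bar R] is the two-point compactification and pairs carry
   the product topology. [d12 F] is only meaningful for continuous [F]; that it
   is then a distribution is not built in. *)
Definition d12 (F : \bar R * \bar R -> R) : testfun R -> R :=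
  fun phi => (\int[lebesgue_measure]_x \int[lebesgue_measure]_y
    (F (x%:E, y%:E) * partial ord0 (partial ord_max phi) (x, y)))%R.

Definition Bc : set (\bar R * \bar R -> R) :=
  [set F | continuous F /\
           forall s : \bar R, F (-oo%E, s) = 0 /\ F (s, -oo%E) = 0].

Definition unorm (F : \bar R * \bar R -> R) : R :=
  sup (range (fun p => `|F p|)).

Definition is_primitive (f : testfun R -> R) (F : \bar R * \bar R -> R) : Prop :=
  Bc F /\ f = d12 F.

Definition Ac : set (testfun R -> R) :=
  [set f | schwartz_distribution f /\ exists F, is_primitive f F].

(* [xget] picks a primitive of [f]; the default value [0] is only used when [f]
   has none. *)
Definition primitive (f : testfun R -> R) : \bar R * \bar R -> R :=
  xget 0 [set F | is_primitive f F].

Definition alexiewicz (f : testfun R -> R) : R := unorm (primitive f).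

End distributions.

(* The subset [S] of [E] is a vector subspace on which [N] is a norm making it
   a Banach space: [S] carries a [completeNormedModType] structure whose
   operations and norm are those of [E] and [N], transported along [j]. *)
Definition banach_subspace (R : realType) (E : lmodType R) (S : set E)
    (N : E -> R) : Prop :=
  exists (V : completeNormedModType R) (j : {linear V -> E}),
    set_bij [set: V] S j /\ forall v : V, N (j v) = `|v|.

Definition linear_on (R : realType) (E E' : lmodType R) (S : set E)
    (T : E -> E') : Prop :=
  forall (a : R) (u v : E), S u -> S v -> T (a *: u + v) = a *: T u + T v.

(* Main.v *)
Require Import Defs.
From HB Require Import structures.
From mathcomp Require Import all_boot all_order all_algebra.
From mathcomp Require Import all_classical all_reals all_analysis.
From mathcomp Require Import ring lra.

Set Implicit Arguments.
Unset Strict Implicit.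
Unset Printing Implicit Defensive.

Import Order.TTheory GRing.Theory Num.Theory.
Import numFieldNormedType.Exports.

Local Open Scope classical_set_scope.
Local Open Scope ring_scope.

(** The whole proposition rests on two facts about the map d12, which sends a
    continuous F on the extended plane to the functional
    phi |-> \int\int F d_1 d_2 phi.

    First, d12 is injective on Bc ([d12_eq0]). Test a vanishing d12 F against
    alpha(x) beta(y), where alpha' is an approximate unit mass at a minus one at
    b, and beta' one at c minus one at d. Shrinking the masses gives
    F(a,c) - F(b,c) - F(a,d) + F(b,d) = 0 for all real a, b, c, d
    ([d12_eq0_mixed_difference]). Letting b and then d tend to -oo, where F
    vanishes, leaves F(a,c) = 0; the real plane is dense in the extended plane,
    so F = 0. Such an alpha is a difference of two rescaled smooth steps, both
    equal to 1 far to the right, so it has compact support although each step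
    does not.

    Secondly, d12 G = 0 as soon as G depends on one variable only ([d12_fst],
    [d12_snd]): with psi = d_2 phi, the y-integral of psi vanishes for every x,
    and the integral of h(y) psi(x,y) in y is a compactly supported function of
    x whose derivative therefore integrates to 0. Differentiating under the
    integral sign replaces both the exchange of the order of integration and
    the equality of mixed derivatives. Hence G and
    G(x,y) - G(-oo,y) - G(x,-oo) + G(-oo,-oo), which lies in Bc, have the same
    image, which is (c).

    The rest is transport of structure. The extended plane is compact, so the
    supremum norm makes Bc a normed space, and it is complete because a uniform
    limit of elements of Bc is in Bc ([bc_cauchy_cvg]); d12 is a linear
    bijection from Bc to Ac and the Alexiewicz norm is by definition the norm
    of the preimage. Since test functions have compact support, every integral
    is an integral of a continuous function over a compact rectangle, where
    integrability, linearity and bounds are elementary ([rect_int_lin],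
    [rect_int_bound]). *)

(** * Integrals of continuous functions over rectangles *)

Section rectangle_integral.
Context {R : realType}.
Local Notation mu := (@lebesgue_measure R).
Implicit Types (g h : R * R -> R) (a b c d : R).

Definition rect_int a b c d g : R :=
  (\int[mu]_(x in `[a, b]) \int[mu]_(y in `[c, d]) g (x, y))%R.

Lemma continuous_slice1 g (x : R) :
  continuous g -> continuous (fun y => g (x, y)).
Proof.
move=> cg y; apply: (@continuous_comp _ _ _ (fun y => (x, y)) g);
  last exact: cg.
exact: (cvg_pair (cvg_cst x) cvg_id).
Qed.

Lemma continuous_slice2 g (y : R) :
  continuous g -> continuous (fun x => g (x, y)).
Proof.
move=> cg x; apply: (@continuous_comp _ _ _ (fun x => (x, y)) g);
  last exact: cg.
exact: (cvg_pair cvg_id (cvg_cst y)).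
Qed.

Lemma integrable_segment (f : R -> R) a b : continuous f ->
  mu.-integrable `[a, b] (EFin \o f).
Proof.
move=> cf; apply: continuous_compact_integrable; first exact: segment_compact.
exact: continuous_subspaceT.
Qed.

Lemma bounded_rect g a b c d : continuous g ->
  exists2 M : R, 0 <= M & forall x y, x \in `[a, b] -> y \in `[c, d] ->
    `|g (x, y)| <= M.
Proof.
move=> cg.
have /compact_bounded[M [_ hM]] : compact (g @` (`[a, b] `*` `[c, d])).
  apply: continuous_compact; first exact: continuous_subspaceT.
  by apply: compact_setX; exact: segment_compact.
(* A bounded set lies in the balls of radius strictly larger than M. *)
exists (`|M| + 1) => // x y xab ycd.
apply: hM; first by rewrite (le_lt_trans (ler_norm M))// ltrDl.
by exists (x, y).
Qed.

Lemma Rintegral_segment_bound (f : R -> R) a b M : a <= b -> continuous f ->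
  (forall x, x \in `[a, b] -> `|f x| <= M) ->
  `|\int[mu]_(x in `[a, b]) f x| <= M * (b - a).
Proof.
move=> ab cf fM.
apply: le_trans.
  by apply: le_normr_Rintegral => //; exact: integrable_segment.
rewrite (_ : M * (b - a) = \int[mu]_(x in `[a, b]) M); last first.
  rewrite Rintegral_cst//= lebesgue_measure_itv/= lte_fin.
  by move: ab; rewrite le_eqVlt => /predU1P[->|->//]; rewrite ltxx subrr.
apply: le_Rintegral => //.
- apply: (@integrable_segment (fun x => `|f x|)) => x.
  by apply: cvg_norm; exact: cf.
- by apply: (@integrable_segment (cst M)); exact: cst_continuous.
Qed.

(** The function is bounded on a compact rectangle around the line over x, so
    dominated convergence applies near x. *)
Lemma continuous_segment_integral g c d : continuous g ->
  continuous (fun x => \int[mu]_(y in `[c, d]) g (x, y)).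
Proof.
move=> cg x.
have [M _ gM] := @bounded_rect g (x - 1) (x + 1) c d cg.
apply: (@continuity_under_integral R _ _ mu (fun x y => g (x, y)) `[c, d] _
  (x - 1) (x + 1) _ _ (cst M)) => //.
- by move=> t _; apply: integrable_segment; exact: continuous_slice1.
- by apply/aeW => y _ t _; exact: (@continuous_slice2 g y cg t).
- by apply: (@integrable_segment (cst M)); exact: cst_continuous.
- move=> t /subset_itv_oo_cc tx; apply/aeW => y ycd; exact: gM.
- by rewrite inE/= in_itv/= ltrBlDr ltrDl ltr01.
Qed.

Lemma rect_int_lin a b c d k g h : continuous g -> continuous h ->
  rect_int a b c d (fun p => k * g p + h p) =
  k * rect_int a b c d g + rect_int a b c d h.
Proof.
move=> cg ch; rewrite /rect_int -RintegralZl//; last first.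
  by apply: integrable_segment; exact: continuous_segment_integral.
rewrite -RintegralD//; last 2 first.
- apply: (@integrable_segment (fun x => k * _)) => x; apply: cvgMl_tmp.
  exact: continuous_segment_integral.
- by apply: integrable_segment; exact: continuous_segment_integral.
apply: eq_Rintegral => x _.
rewrite -RintegralZl//; last first.
  by apply: integrable_segment; exact: continuous_slice1.
rewrite -RintegralD//; last first.
  by apply: integrable_segment; exact: continuous_slice1.
apply: (@integrable_segment (fun y => k * g (x, y))) => y; apply: cvgMl_tmp.
exact: continuous_slice1.
Qed.

Lemma rect_int_bound a b c d g M : a <= b -> c <= d -> continuous g ->
  (forall x y, x \in `[a, b] -> y \in `[c, d] -> `|g (x, y)| <= M) ->
  `|rect_int a b c d g| <= M * (d - c) * (b - a).
Proof.
move=> ab cd cg gM; apply: Rintegral_segment_bound => //.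
  exact: continuous_segment_integral.
move=> x xab; apply: Rintegral_segment_bound => //;
  first exact: continuous_slice1.
by move=> y ycd; exact: gM.
Qed.

Lemma Rintegral_restrict (f : R -> R) a b :
  (forall x, x \notin `[a, b] -> f x = 0) ->
  \int[mu]_x f x = \int[mu]_(x in `[a, b]) f x.
Proof.
move=> f0; rewrite [RHS]Rintegral_mkcond; apply: eq_Rintegral => x _.
rewrite patchE; case: ifPn => // /negP nx; apply: f0; apply/negP => h.
by apply: nx; rewrite inE.
Qed.

(** Passes from integrals over the whole plane to integrals over any rectangle
    that carries the function. It is used in both directions: to localize, and
    to move two integrals onto one common rectangle before adding them. *)
Lemma rect_intE a b c d g :
  (forall x y, (x \notin `[a, b]) || (y \notin `[c, d]) -> g (x, y) = 0) ->
  (\int[mu]_x \int[mu]_y g (x, y))%R = rect_int a b c d g.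
Proof.
move=> g0; rewrite (@Rintegral_restrict _ a b) => [|x xab].
  apply: eq_Rintegral => x _; apply: Rintegral_restrict => y ycd.
  by rewrite g0// ycd orbT.
under eq_Rintegral do rewrite g0 ?xab//.
by rewrite Rintegral_cst//= mul0r.
Qed.

(** A continuous partial derivative is bounded on a compact rectangle around the
    line over x, and this constant dominates the difference quotients. *)
Lemma is_derive_segment_integral g g' c d (x : R) :
  continuous g -> continuous g' ->
  (forall t y : R, is_derive t 1 (fun s => g (s, y)) (g' (t, y))) ->
  is_derive x 1 (fun t => \int[mu]_(y in `[c, d]) g (t, y))
    (\int[mu]_(y in `[c, d]) g' (x, y)).
Proof.
move=> cg cg' dg.
have [M M0 gM] := @bounded_rect g' (x - 1) (x + 1) c d cg'.
have xI : `]x - 1, x + 1[%classic x.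
  by rewrite /= in_itv/= ltrBlDr ltrDl ltr01.
have intg t : `]x - 1, x + 1[%classic t ->
    mu.-integrable `[c, d] (EFin \o (fun y => g (t, y))).
  by move=> _; apply: integrable_segment; exact: continuous_slice1.
have derg t y : `]x - 1, x + 1[%classic t -> `[c, d]%classic y ->
    derivable (fun s => g (s, y)) t 1.
  by move=> _ _; have [] := dg t y.
have M0' (y : R) : 0 <= cst M y by [].
have intM : mu.-integrable `[c, d] (EFin \o cst M).
  by apply: integrable_segment; exact: cst_continuous.
have d1E t y : partial1of2 (fun x y => g (x, y)) t y = g' (t, y).
  by rewrite partial1of2E; have [_ ->] := dg t y.
have gM' t y : `]x - 1, x + 1[%classic t -> `[c, d]%classic y ->
    `|partial1of2 (fun x y => g (x, y)) t y| <= cst M y.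
  by move=> /subset_itv_oo_cc tx ycd; rewrite d1E; exact: gM.
have mcd : measurable (`[c, d] : set R) by [].
apply: DeriveDef.
  exact: (@derivable_under_integral _ _ _ mu (fun x y => g (x, y)) _ mcd _ _ _
    xI intg derg _ M0' intM gM').
rewrite -derive1E (@differentiation_under_integral _ _ _ mu
  (fun x y => g (x, y)) _ mcd _ _ _ xI intg derg _ M0' intM gM').
by apply: eq_Rintegral => y _; rewrite d1E.
Qed.

Lemma Rintegral_FTC2 (f F : R -> R) a b : a < b -> continuous f ->
  (forall x : R, is_derive x 1 F (f x)) ->
  \int[mu]_(x in `[a, b]) f x = F b - F a.
Proof.
move=> ab cf dF.
have cF : continuous F.
  move=> x; apply/differentiable_continuous/derivable1_diffP.
  by have [] := dF x.
rewrite /Rintegral (@continuous_FTC2 _ f F)//.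
- exact: continuous_subspaceT.
- split=> [x _||]; first by have [] := dF x.
    exact/cvg_at_right_filter/cF.
  exact/cvg_at_left_filter/cF.
- by move=> x _; rewrite derive1E; have [_ ->] := dF x.
Qed.

End rectangle_integral.

(** * Partial derivatives and supports of test functions *)

Section test_function_facts.
Context {R : realType}.
Implicit Types (phi psi : R * R -> R) (f : testfun R).

(** Along a basis vector the difference quotients in the plane are literally
    those of a function of one variable, so derivability and the value of the
    derivative can be carried over in both directions. *)
Lemma quotient_slice1 phi (x y : R) :
  (fun h : R => h^-1 *:
    (phi (h *: (basis_vec ord0 : R * R) + (x, y)) - phi (x, y))) =
  (fun h : R => h^-1 *: (phi (h *: (1 : R^o) + x, y) - phi (x, y))).
Proof.
apply/funext => h; congr (_ *: (phi _ - _)).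
by rewrite /basis_vec eqxx; congr pair; rewrite /= scaler0 add0r.
Qed.

Lemma quotient_slice2 phi (x y : R) :
  (fun h : R => h^-1 *:
    (phi (h *: (basis_vec ord_max : R * R) + (x, y)) - phi (x, y))) =
  (fun h : R => h^-1 *: (phi (x, h *: (1 : R^o) + y) - phi (x, y))).
Proof.
apply/funext => h; congr (_ *: (phi _ - _)).
by rewrite /basis_vec/=; congr pair; rewrite /= scaler0 add0r.
Qed.

Lemma is_derive_slice1P phi (x y : R) (l : R) :
  is_derive (x, y) (basis_vec ord0) phi l <->
  is_derive x 1 (fun s => phi (s, y)) l.
Proof.
have E := quotient_slice1 phi x y.
by split=> -[]; rewrite /derivable /derive /= => d <-; split;
  rewrite /derivable /derive /= ?E// -E.
Qed.

Lemma is_derive_slice2P phi (x y : R) (l : R) :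
  is_derive (x, y) (basis_vec ord_max) phi l <->
  is_derive y 1 (fun s => phi (x, s)) l.
Proof.
have E := quotient_slice2 phi x y.
by split=> -[]; rewrite /derivable /derive /= => d <-; split;
  rewrite /derivable /derive /= ?E// -E.
Qed.

Lemma smooth_partials phi s : smooth phi -> smooth (partials s phi).
Proof.
move=> sphi t; have := sphi (t ++ s).
by rewrite /partials foldr_cat.
Qed.

Lemma smooth_is_derive1 phi (x y : R) : smooth phi ->
  is_derive x 1 (fun s => phi (s, y)) (partial ord0 phi (x, y)).
Proof.
by move=> /(_ [::])[_ /(_ ord0 (x, y)) d]; apply/is_derive_slice1P;
  exact: derivableP.
Qed.

Lemma smooth_is_derive2 phi (x y : R) : smooth phi ->
  is_derive y 1 (fun s => phi (x, s)) (partial ord_max phi (x, y)).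
Proof.
by move=> /(_ [::])[_ /(_ ord_max (x, y)) d]; apply/is_derive_slice2P;
  exact: derivableP.
Qed.

(** The complement of the support is open, so the function vanishes near each of
    its points; hence so does every iterated derivative. *)
Lemma partials_tsupport s phi p : ~ tsupport phi p -> partials s phi p = 0.
Proof.
elim: s p => [|i s IH] p np /=.
  by apply: contrapT => /eqP p0; apply: np; exact: subset_closure.
have np' : \forall q \near p, partials s phi q = cst 0 q.
  have : nbhs p (~` tsupport phi).
    by apply: open_nbhs_nbhs; split => //; exact/closed_openC/closed_closure.
  by apply: filterS => q; exact: IH.
by rewrite /partial (near_eq_derive _ np') derive_cst.
Qed.

Lemma compact_in_square (K : set (R * R)) : compact K ->
  exists2 B : R, 0 < B & forall x y, K (x, y) ->
    (x \in `[- B, B]) && (y \in `[- B, B]).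
Proof.
move=> /compact_bounded[M [_ hM]].
exists (`|M| + 1); first by rewrite ltr_wpDl.
move=> x y Kxy; have /hM/(_ (x, y) Kxy) : M < `|M| + 1.
  by rewrite (le_lt_trans (ler_norm M))// ltrDl.
by rewrite /Num.norm/= ge_max !ler_norml => /andP[xM yM];
  rewrite !in_itv/= xM yM.
Qed.

Lemma test_smooth f : smooth f.
Proof. by case: f => phi /=; rewrite inE => -[]. Qed.

Lemma test_compact f : compact (tsupport f).
Proof. by case: f => phi /=; rewrite inE => -[]. Qed.

Lemma partials_out f B s x y :
  (forall x y, tsupport f (x, y) -> (x \in `[- B, B]) && (y \in `[- B, B])) ->
  (x \notin `[- B, B]) || (y \notin `[- B, B]) -> partials s f (x, y) = 0.
Proof.
move=> fB; rewrite -negb_and => xy.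
by apply: partials_tsupport => /fB; apply/negP.
Qed.

Lemma uniform_cvg_norm (u : nat -> R * R -> R) v :
  {uniform, u @ \oo --> v} ->
  forall e : R, 0 < e -> \forall n \near \oo, forall p, `|v p - u n p| < e.
Proof.
move=> uv e e0.
have : nbhs (v : {uniform` setT -> R}) [set h | forall p, `|v p - h p| < e].
  apply/uniform_nbhs; exists [set xy | ball xy.1 e xy.2]; split.
    exact: entourage_ball (PosNum e0).
  by move=> h /= hb p; exact: hb.
by move=> /uv.
Qed.

End test_function_facts.

(** * The derivative of a continuous function as a distribution *)

Section derivative_d12.
Context {R : realType}.
Local Notation mu := (@lebesgue_measure R).
Implicit Types (F G : \bar R * \bar R -> R) (f : testfun R).

Definition finite_part F : R * R -> R := fun p => F (p.1%:E, p.2%:E).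

Lemma continuous_EFin : continuous (@EFin R).
Proof. by move=> x A /nbhs_EFin. Qed.

Lemma continuous_finite_part F : continuous F -> continuous (finite_part F).
Proof.
move=> cF p; apply: (@continuous_comp _ _ _ (fun p => (p.1%:E, p.2%:E)) F);
  last exact: cF.
have h1 : q.1%:E @[q --> p] --> p.1%:E.
  by apply: (cvg_comp _ _ cvg_fst); exact: continuous_EFin.
have h2 : q.2%:E @[q --> p] --> p.2%:E.
  by apply: (cvg_comp _ _ cvg_snd); exact: continuous_EFin.
exact: (cvg_pair h1 h2).
Qed.

Definition d12_kernel F (phi : R * R -> R) (p : R * R) : R :=
  finite_part F p * partials [:: ord0; ord_max] phi p.

Lemma continuous_d12_kernel F f : continuous F -> continuous (d12_kernel F f).
Proof.
move=> cF p; apply: cvgM; first exact: continuous_finite_part.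
exact: (test_smooth f [:: ord0; ord_max]).1.
Qed.

Lemma d12E F f B :
  (forall x y, tsupport f (x, y) -> (x \in `[- B, B]) && (y \in `[- B, B])) ->
  d12 F f = rect_int (- B) B (- B) B (d12_kernel F f).
Proof.
move=> fB; apply: rect_intE => x y xy.
by rewrite /d12_kernel (partials_out _ fB) ?mulr0.
Qed.

End derivative_d12.

Section d12_distribution.
Context {R : realType}.
Local Notation mu := (@lebesgue_measure R).
Implicit Types (F G : \bar R * \bar R -> R) (f : testfun R).

Lemma d12_linear_testfun F (a : R) f (g : testfun R) : continuous F ->
  d12 F (a *: f + g) = a * d12 F f + d12 F g.
Proof.
move=> cF.
have [B _ hB] := compact_in_square (compactU
  (compactU (@test_compact R (a *: f + g)) (@test_compact R f))
  (@test_compact R g)).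
rewrite !(@d12E _ _ _ B);
  [|by move=> x y xy; apply: hB; rewrite /setU/=; tauto..].
rewrite -rect_int_lin; [|exact: continuous_d12_kernel..].
congr rect_int; apply/funext => p; rewrite /d12_kernel.
have -> : testfun_val (a *: f + g) = a *: testfun_val f + testfun_val g by [].
rewrite partials_lin; [|exact: test_smooth..].
by rewrite addrfctE scalrfctE mulrDr/= mulrCA.
Qed.

(** All supports lie in one square, where F is bounded by some M, so the error
    is at most M times the area times the uniform distance of the mixed
    derivatives. *)
Lemma d12_cvg F (f_ : nat -> testfun R) f : continuous F -> test_cvg f_ f ->
  d12 F (f_ n) @[n --> \oo] --> d12 F f.
Proof.
move=> cF [[K cK fK] /(_ [:: ord0; ord_max]) /uniform_cvg_norm cvf].
have [B B0 hB] := compact_in_square (compactU cK (@test_compact R f)).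
have BB : - B <= B by rewrite ge0_cp// ltW.
have [M M0 hM] := bounded_rect (- B) B (- B) B (continuous_finite_part cF).
have dE (g : testfun R) :
    (forall x y, tsupport g (x, y) -> (K `|` tsupport f) (x, y)) ->
    d12 F g = rect_int (- B) B (- B) B (d12_kernel F g).
  by move=> gK; apply: d12E => x y /gK; exact: hB.
apply/cvgrPdist_le => e e0.
(* M + 1 instead of M, so that C can be divided by. *)
pose C := (M + 1) * (B - - B) * (B - - B).
have C0 : 0 < C.
  by rewrite /C; apply: mulr_gt0; [apply: mulr_gt0|]; lra.
have := cvf (e / C) (divr_gt0 e0 C0); apply: filterS => n hn.
rewrite !dE; [|by move=> x y /fK; left|by move=> x y; right].
have -> : rect_int (- B) B (- B) B (d12_kernel F f) -
    rect_int (- B) B (- B) B (d12_kernel F (f_ n)) =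
    rect_int (- B) B (- B) B
      (fun p => (-1) * d12_kernel F (f_ n) p + d12_kernel F f p).
  by rewrite rect_int_lin;
    [rewrite mulN1r addrC|exact: continuous_d12_kernel..].
apply: (@le_trans _ _ (M * (e / C) * (B - - B) * (B - - B))).
  apply: rect_int_bound => // [p|x y xB yB].
    apply: cvgD; last exact: continuous_d12_kernel.
    by apply: cvgMl_tmp; exact: continuous_d12_kernel.
  rewrite /d12_kernel mulN1r addrC -mulrBr normrM.
  by apply: ler_pM => //; [exact: hM|exact: ltW].
have -> : M * (e / C) * (B - - B) * (B - - B) =
    (M * (B - - B) * (B - - B)) / C * e by ring.
rewrite ler_piMl ?(ltW e0)// ler_pdivrMr// mul1r /C.
by rewrite !ler_pM2r ?lerDl// opprK addr_gt0.
Qed.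

Lemma d12_distribution F : continuous F -> schwartz_distribution (d12 F).
Proof.
move=> cF; split; last by move=> f_ f; exact: d12_cvg.
by move=> a f g; exact: d12_linear_testfun.
Qed.

Lemma d12_linear F G (a : R) : continuous F -> continuous G ->
  d12 (a *: F + G) = a *: d12 F + d12 G.
Proof.
move=> cF cG; apply/funext => f.
have [B _ hB] := compact_in_square (@test_compact R f).
rewrite -[RHS]/(a * d12 F f + d12 G f) !(@d12E _ _ _ B)//.
rewrite -rect_int_lin; [|exact: continuous_d12_kernel..].
congr rect_int; apply/funext => p; rewrite /d12_kernel /finite_part.
by rewrite addrfctE scalrfctE mulrDl mulrA /GRing.scale.
Qed.

(** Enlarging a square that contains the support by 1 keeps the containment and
    makes every derivative vanish on the boundary of the square. *)
Lemma vanishing_square f : exists B : R, [/\ - B < B,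
  forall x y, tsupport f (x, y) -> (x \in `[- B, B]) && (y \in `[- B, B]),
  forall s t, partials s f (B, t) = 0 /\ partials s f (- B, t) = 0 &
  forall s t, partials s f (t, B) = 0 /\ partials s f (t, - B) = 0].
Proof.
have [B B0 hB] := compact_in_square (@test_compact R f).
exists (B + 1).
have out (b : R) : b = B + 1 \/ b = - (B + 1) -> b \notin `[- B, B].
  by rewrite in_itv/= => -[->|->]; lra.
have Pout := out _ (or_introl erefl); have Nout := out _ (or_intror erefl).
split=> [|x y /hB|s t|s t]; first by lra.
- by rewrite !in_itv/= => /andP[/andP[? ?] /andP[? ?]]; apply/andP; split; lra.
- by split; apply: (partials_out _ hB); rewrite ?Pout ?Nout.
- by split; apply: (partials_out _ hB); rewrite ?Pout ?Nout orbT.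
Qed.

(** The inner integral is h(x) times the y-integral of d_1 psi, which is the
    derivative in x of the y-integral of psi = d_2 phi; the latter is
    identically 0 by the fundamental theorem of calculus. *)
Lemma d12_fst (h : \bar R -> R) : continuous h -> d12 (fun p => h p.1) = 0.
Proof.
move=> ch; apply/funext => f.
have ch1 : continuous (fun p : \bar R * \bar R => h p.1).
  by move=> p; apply: (@continuous_comp _ _ _ fst h);
    [exact: cvg_fst|exact: ch].
have [B [BB hB _ out]] := vanishing_square f.
rewrite (d12E _ hB) /rect_int; set psi := partial ord_max f.
have spsi : smooth psi.
  exact: (@smooth_partials _ _ [:: ord_max] (@test_smooth R f)).
have c1 : continuous (partial ord0 psi) by exact: (spsi [:: ord0]).1.
(* phi vanishes at both ends of the segment. *)
have psi0 (x : R) : \int[mu]_(y in `[- B, B]) psi (x, y) = 0.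
  have cpx : continuous (fun y => psi (x, y)).
    by apply: continuous_slice1; exact: (spsi [::]).1.
  have df y := smooth_is_derive2 x y (@test_smooth R f).
  rewrite (Rintegral_FTC2 BB cpx df).
  by have [/= -> ->] := out [::] x; rewrite subrr.
have dpsi0 (x : R) : \int[mu]_(y in `[- B, B]) partial ord0 psi (x, y) = 0.
  have := @is_derive_segment_integral _ psi (partial ord0 psi) (- B) B x
    (spsi [::]).1 c1 (fun t y => smooth_is_derive1 t y spsi).
  under eq_fun do rewrite psi0.
  by move=> [_ <-]; rewrite derive_cst.
rewrite (@eq_Rintegral _ _ _ mu _ (cst 0)) => [|x _].
  by rewrite Rintegral_cst//= mul0r.
rewrite /d12_kernel /finite_part /= RintegralZl ?dpsi0 ?mulr0//.
by apply: integrable_segment; exact: continuous_slice1.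
Qed.

(** With psi = d_2 phi, the inner integral is the derivative of Q(x) = \int h(y)
    psi(x,y) dy, and Q vanishes at both ends of the square. *)
Lemma d12_snd (h : \bar R -> R) : continuous h -> d12 (fun p => h p.2) = 0.
Proof.
move=> ch; apply/funext => f.
have ch2 : continuous (fun p : \bar R * \bar R => h p.2).
  by move=> p; apply: (@continuous_comp _ _ _ snd h);
    [exact: cvg_snd|exact: ch].
have [B [BB hB out _]] := vanishing_square f.
rewrite (d12E _ hB) /rect_int; set psi := partial ord_max f.
have spsi : smooth psi.
  exact: (@smooth_partials _ _ [:: ord_max] (@test_smooth R f)).
pose w := finite_part (fun p => h p.2).
pose Q x := \int[mu]_(y in `[- B, B]) (w (x, y) * psi (x, y)).
have cp : continuous (fun p => w p * psi p).
  by move=> p; apply: cvgM;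
    [exact: continuous_finite_part|exact: (spsi [::]).1].
have ck : continuous (d12_kernel (fun p => h p.2) f).
  exact: continuous_d12_kernel.
have dQ (x : R) : is_derive x 1 Q
    (\int[mu]_(y in `[- B, B]) d12_kernel (fun p => h p.2) f (x, y)).
  apply: (@is_derive_segment_integral R _ _ (- B) B x cp ck) => t y.
  have := @is_deriveM _ _ (cst (w (t, y))) (fun s => psi (s, y)) t 1 _ _
    (is_derive_cst _ _ _) (smooth_is_derive1 t y spsi).
  by move=> /is_derive_eq; apply; rewrite scaler0 addr0.
rewrite (Rintegral_FTC2 BB (@continuous_segment_integral R _ (- B) B ck) dQ).
have Q0 b : (forall y, psi (b, y) = 0) -> Q b = 0.
  move=> p0; rewrite /Q (@eq_Rintegral _ _ _ mu _ (cst 0)) => [|y _].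
    by rewrite Rintegral_cst//= mul0r.
  by rewrite p0 mulr0.
by rewrite !Q0 ?subrr// => y; have [] := out [:: ord_max] y.
Qed.

End d12_distribution.

(** * A smooth step *)

Section smooth_step.
Context {R : realType}.
Implicit Types (x : R) (f g : R -> R) (n : nat).

(** The classical flat function exp(-1/x), together with its products by the
    powers of 1/x: the whole family is needed since it is its linear
    combinations that are closed under derivation. *)
Definition flat n x : R := if 0 < x then x^-1 ^+ n * expR (- x^-1) else 0.

Lemma flat_le0 n x : x <= 0 -> flat n x = 0.
Proof. by rewrite /flat ltNge => ->. Qed.

Lemma flat_gt0 n x : 0 < x -> 0 < flat n x.
Proof.
by rewrite /flat => x0; rewrite x0 mulr_gt0 ?expR_gt0 ?exprn_gt0 ?invr_gt0.
Qed.

Lemma flat_ge0 n x : 0 <= flat n x.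
Proof. by have [/flat_le0->//|/flat_gt0 h] := leP x 0; exact/ltW. Qed.

(** With y = 1/x, this is y ^ n.+1 / n.+1! <= exp y, a term of the exponential
    series. *)
Lemma flat_bound n x : `|flat n x| <= n.+1`!%:R * `|x|.
Proof.
rewrite ger0_norm ?flat_ge0//.
have [x0|x0] := leP x 0; first by rewrite flat_le0// mulr_ge0.
rewrite /flat x0 gtr0_norm// expRN ler_pdivrMr ?expR_gt0//.
have y0 : 0 < x^-1 by rewrite invr_gt0.
have -> : x^-1 ^+ n = x * x^-1 ^+ n.+1.
  by rewrite exprS mulrA divff ?mul1r ?gt_eqF.
rewrite mulrAC mulrC ler_pM2r// mulrC -ler_pdivrMr ?ltr0n ?fact_gt0//.
by apply: le_trans (expR_ge1Dxn n (ltW y0)); rewrite lerDr.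
Qed.

Lemma flat_cvg0 n : flat n x @[x --> 0^'] --> 0.
Proof. exact: (cvg_to_0_linear ltr01 (fun x _ => flat_bound n x)). Qed.

(** At 0, the difference quotient of [flat n] is exactly [flat n.+1], so
    derivability there is the convergence to 0 of the next function of the
    family. *)
Lemma is_derive_flat n x :
  is_derive x 1 (flat n) (- n%:R * flat n.+1 x + flat n.+2 x).
Proof.
have [x0|x0|->] := ltgtP x 0.
- rewrite !flat_le0 ?ltW// mulr0 addr0.
  apply: (@near_eq_is_derive _ _ _ (cst 0)).
  by near=> y; rewrite flat_le0// ltW//; near: y; exact: lt_nbhsl.
- apply: (@near_eq_is_derive _ _ _
    ((fun y => y ^+ n * expR (- y)) \o (fun y : R => y^-1))).
    by near=> y; rewrite /flat ifT//; near: y; exact: lt_nbhsr.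
  have d1 : is_derive x 1 (fun y : R => y^-1) (- x ^- 2 *: 1).
    by apply: (@is_deriveV _ id); rewrite gt_eqF.
  have d2 (y : R) : is_derive y 1 (fun y : R => y ^+ n * expR (- y))
     (y ^+ n * - expR (- y) + expR (- y) * (n%:R * y ^+ n.-1)).
    have dX : is_derive y 1 ((@GRing.exp R)^~ n) (n%:R * y ^+ n.-1).
      by apply: DeriveDef; [exact: exprn_derivable|rewrite exp_derive scaler1].
    have dE : is_derive y 1 (fun y : R => expR (- y)) (- expR (- y)).
      have := @is_derive1_comp _ expR -%R y _ _ (is_derive_expR _)
        (is_deriveNid _ _).
      by move=> /is_derive_eq; apply; rewrite mulrN1.
    exact: (is_deriveM dX dE).
  have := is_derive1_comp (d2 x^-1) d1.
  move=> /is_derive_eq; apply.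
  rewrite /flat x0 /GRing.scale/= -exprVn; set y := x^-1.
  by case: n {d2} => [|n]; rewrite /= !exprS; ring.
- have E : (fun h : R => h^-1 *: (flat n (h *: (1 : R^o) + 0) - flat n 0)) =
      flat n.+1.
    apply/funext => h; rewrite (flat_le0 _ (lexx 0)) subr0 addr0.
    rewrite /flat /GRing.scale/= mulr1; case: ifP => _; rewrite ?mulr0//.
    by rewrite exprS mulrA.
  rewrite !(flat_le0 _ (lexx 0)) mulr0 addr0.
  have c : h^-1 *: (flat n (h *: (1 : R^o) + 0) - flat n 0) @[h --> 0^'] -->
      (0 : R).
    by rewrite E; exact: flat_cvg0.
  by apply: DeriveDef; [exact: cvgP c|exact: cvg_lim c].
Unshelve. all: end_near. Qed.

(** Smoothness of the functions of one variable in use is obtained from a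
    syntactic class, built so that it contains the derivative of each of its
    members: one derivation step then gives all orders at once. *)
Inductive flat_generated : (R -> R) -> Prop :=
| fg_flat n : flat_generated (flat n)
| fg_cst c : flat_generated (fun=> c)
| fg_add f g : flat_generated f -> flat_generated g ->
    flat_generated (fun x => f x + g x)
| fg_mul f g : flat_generated f -> flat_generated g ->
    flat_generated (fun x => f x * g x)
| fg_affine a b f : flat_generated f ->
    flat_generated (fun x => f (a * (x - b)))
| fg_inv f : (forall x, f x != 0) -> flat_generated f ->
    flat_generated (fun x => (f x)^-1).

Lemma flat_generated_is_derive f : flat_generated f ->
  exists2 g, flat_generated g & forall x, is_derive x 1 f (g x).
Proof.
elim=> {f} [n|c|f g _ [f' sf df] _ [g' sg dg]|f g sf0 [f' sf df] sg0 [g' sg dg]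
  |a b f _ [f' sf df]|f f0 sf0 [f' sf df]].
- exists (fun x => - n%:R * flat n.+1 x + flat n.+2 x);
    last exact: is_derive_flat.
  apply: fg_add; last exact: fg_flat.
  by apply: (@fg_mul (fun=> - n%:R) (flat n.+1));
    [exact: fg_cst|exact: fg_flat].
- by exists (fun=> 0); [exact: fg_cst|move=> x; exact: is_derive_cst].
- by exists (fun x => f' x + g' x); [exact: fg_add|move=> x; exact: is_deriveD].
- exists (fun x => f x * g' x + g x * f' x).
    by apply: fg_add; exact: fg_mul.
  by move=> x; exact: is_deriveM.
- exists (fun x => f' (a * (x - b)) * a).
    by apply: (@fg_mul _ (fun=> a)); [exact: fg_affine|exact: fg_cst].
  move=> x; apply: (@is_derive1_comp _ f (fun x => a * (x - b))).
  have := @is_deriveM _ _ (cst a) (fun x => x - b) x 1 _ _ (is_derive_cst _ _ _)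
    (is_derive_shift x 1 (- b)).
  by move=> /is_derive_eq; apply; rewrite scaler0 addr0 /GRing.scale/= mulr1.
- exists (fun x => - 1 * ((f x)^-1 * (f x)^-1) * f' x).
    apply: fg_mul => //.
    apply: (@fg_mul (fun=> - 1) (fun x => _ * _)); first exact: fg_cst.
    by apply: fg_mul; exact: fg_inv.
  move=> x; have := @is_deriveV _ _ _ _ 1 (f0 x) (df x).
  by move=> /is_derive_eq; apply; rewrite /GRing.scale/= mulN1r -exprVn expr2.
Qed.

Lemma flat_generated_continuous f : flat_generated f -> continuous f.
Proof.
move=> /flat_generated_is_derive[g _ df] x.
by apply/differentiable_continuous/derivable1_diffP; have [] := df x.
Qed.

Lemma flat_generated_derive1 f : flat_generated f ->
  flat_generated (derive1 f) /\ forall x, is_derive x 1 f (derive1 f x).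
Proof.
move=> /flat_generated_is_derive[g sg df].
suff -> : derive1 f = g by [].
by apply/funext => x; rewrite derive1E; have [_ ->] := df x.
Qed.

(** The denominator is positive: x and 1 - x are not both nonpositive. *)
Definition step x : R := flat 0 x / (flat 0 x + flat 0 (1 - x)).

Lemma flat_generated_step : flat_generated step.
Proof.
apply: fg_mul; first exact: fg_flat.
apply: fg_inv => [x|].
  have [x0|x0] := leP x 0;
    last by rewrite gt_eqF// ltr_wpDr ?flat_ge0 ?flat_gt0.
  by rewrite gt_eqF// ltr_wpDl ?flat_ge0 ?flat_gt0//; lra.
apply: fg_add; first exact: fg_flat.
rewrite (_ : (fun x => flat 0 (1 - x)) = (fun x => flat 0 (- 1 * (x - 1)))).
  by apply: fg_affine; exact: fg_flat.
by apply/funext => x; congr flat; ring.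
Qed.

Lemma step_le0 x : x <= 0 -> step x = 0.
Proof. by move=> x0; rewrite /step flat_le0// mul0r. Qed.

Lemma step_ge1 x : 1 <= x -> step x = 1.
Proof.
move=> x1; rewrite /step (@flat_le0 0 (1 - x)) ?subr_le0// addr0 divff//.
by rewrite gt_eqF// flat_gt0// (lt_le_trans ltr01).
Qed.

Lemma derive1_step_eq0 x : x \notin `[0, 1] -> derive1 step x = 0.
Proof.
rewrite in_itv/= negb_and -!ltNge => /orP[x0|x1]; rewrite derive1E.
  rewrite (@near_eq_derive _ _ _ _ (cst 0)) ?derive_cst//.
  by near=> y; rewrite step_le0// ltW//; near: y; exact: lt_nbhsl.
rewrite (@near_eq_derive _ _ _ _ (cst (1 : R))) ?derive_cst//.
by near=> y; rewrite step_ge1// ltW//; near: y; exact: lt_nbhsr.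
Unshelve. all: end_near. Qed.

Lemma derive1_step_bounded :
  exists2 M : R, 0 <= M & forall x, `|derive1 step x| <= M.
Proof.
have c : continuous (derive1 step).
  apply: flat_generated_continuous.
  exact: (flat_generated_derive1 flat_generated_step).1.
have /compact_bounded[M [_ hM]] : compact (derive1 step @` `[0, 1]).
  by apply: continuous_compact;
    [exact: continuous_subspaceT|exact: segment_compact].
exists (`|M| + 1) => // x.
have [x01|x01] := boolP (x \in `[0, 1]);
  last by rewrite derive1_step_eq0// normr0.
by apply: hM; [rewrite (le_lt_trans (ler_norm M))// ltrDl|exists x].
Qed.

Definition ramp (d a x : R) : R := step (d^-1 * (x - a)).

(** The derivative of [ramp d a]: an approximate unit mass at a, of integral 1,
    supported in a segment of length d, and of size O(1/d). *)
Definition pulse (d a x : R) : R := d^-1 * derive1 step (d^-1 * (x - a)).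

Lemma flat_generated_ramp d a : flat_generated (ramp d a).
Proof. by apply: fg_affine; exact: flat_generated_step. Qed.

Lemma is_derive_ramp d a x : is_derive x 1 (ramp d a) (pulse d a x).
Proof.
have dstep := (flat_generated_derive1 flat_generated_step).2.
rewrite /pulse mulrC.
apply: (@is_derive1_comp _ step (fun x => d^-1 * (x - a))).
have := @is_deriveM _ _ (cst d^-1) (fun x => x - a) x 1 _ _
  (is_derive_cst _ _ _) (is_derive_shift x 1 (- a)).
by move=> /is_derive_eq; apply; rewrite scaler0 addr0 /GRing.scale/= mulr1.
Qed.

Lemma continuous_pulse d a : continuous (pulse d a).
Proof.
apply: flat_generated_continuous; apply: (@fg_mul (fun=> d^-1));
  first exact: fg_cst.
apply: fg_affine; exact: (flat_generated_derive1 flat_generated_step).1.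
Qed.

Lemma ramp_le d a x : 0 < d -> x <= a -> ramp d a x = 0.
Proof.
by move=> d0 xa; rewrite /ramp step_le0// pmulr_rle0 ?invr_gt0// subr_le0.
Qed.

Lemma ramp_ge d a x : 0 < d -> a + d <= x -> ramp d a x = 1.
Proof.
move=> d0 xa; rewrite /ramp step_ge1// ler_pdivlMl// mulr1; lra.
Qed.

Lemma pulse_eq0 d a x : 0 < d -> x \notin `[a, a + d] -> pulse d a x = 0.
Proof.
move=> d0 xa; rewrite /pulse derive1_step_eq0 ?mulr0//.
apply: contra xa; rewrite !in_itv/= ler_pdivrMl// mulr1 pmulr_rge0 ?invr_gt0//.
by move=> /andP[h1 h2]; lra.
Qed.

Lemma Rintegral_pulse d a : 0 < d ->
  \int[@lebesgue_measure R]_(x in `[a, a + d]) pulse d a x = 1.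
Proof.
move=> d0; have ad : a < a + d by rewrite ltrDl.
rewrite (Rintegral_FTC2 ad (@continuous_pulse d a) (is_derive_ramp d a)).
by rewrite ramp_ge// ramp_le// subr0.
Qed.

End smooth_step.

(** * Test functions with separated variables *)

Section tensor.
Context {R : realType}.
Implicit Types (u v : R -> R).

Definition tensor u v : R * R -> R := fun p => u p.1 * v p.2.

Lemma is_derive_tensor1 u u' v (x y : R) : is_derive x 1 u (u' x) ->
  is_derive (x, y) (basis_vec ord0) (tensor u v) (tensor u' v (x, y)).
Proof.
move=> du; apply/is_derive_slice1P.
have := is_deriveM du (is_derive_cst (v y) x 1).
by move=> /is_derive_eq; apply;
  rewrite scaler0 add0r /tensor /GRing.scale/= mulrC.
Qed.

Lemma is_derive_tensor2 u v v' (x y : R) : is_derive y 1 v (v' y) ->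
  is_derive (x, y) (basis_vec ord_max) (tensor u v) (tensor u v' (x, y)).
Proof.
move=> dv; apply/is_derive_slice2P.
have := is_deriveM (is_derive_cst (u x) y 1) dv.
by move=> /is_derive_eq; apply; rewrite scaler0 addr0 /tensor.
Qed.

Lemma partial_tensor1 u u' v : (forall x : R, is_derive x 1 u (u' x)) ->
  partial ord0 (tensor u v) = tensor u' v.
Proof.
move=> du; apply/funext => -[x y]; rewrite /partial.
by have [_ ->] := is_derive_tensor1 v y (du x).
Qed.

Lemma partial_tensor2 u v v' : (forall x : R, is_derive x 1 v (v' x)) ->
  partial ord_max (tensor u v) = tensor u v'.
Proof.
move=> dv; apply/funext => -[x y]; rewrite /partial.
by have [_ ->] := is_derive_tensor2 u x (dv y).
Qed.

Lemma ord2P (i : 'I_2) : i = ord0 \/ i = ord_max.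
Proof. by case: i => -[|[|//]] i; [left|right]; exact: val_inj. Qed.

Lemma partials_tensor s u v : flat_generated u -> flat_generated v ->
  exists u' v', [/\ flat_generated u', flat_generated v' &
    partials s (tensor u v) = tensor u' v'].
Proof.
(* [partials] applies the head of s last, so the induction hypothesis is
   differentiated once more. *)
move=> su sv; elim: s => [|i s [u' [v' [su' sv' E]]]] /=; first by exists u, v.
rewrite E.
have [->|->] := ord2P i.
  have [w sw dw] := flat_generated_is_derive su'.
  by exists w, v'; split => //; exact: partial_tensor1.
have [w sw dw] := flat_generated_is_derive sv'.
by exists u', w; split => //; exact: partial_tensor2.
Qed.

Lemma continuous_tensor u v :
  continuous u -> continuous v -> continuous (tensor u v).
Proof.
move=> cu cv p; apply: cvgM.
  by apply: (cvg_comp _ _ cvg_fst); exact: cu.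
by apply: (cvg_comp _ _ cvg_snd); exact: cv.
Qed.

Lemma smooth_tensor u v : flat_generated u -> flat_generated v ->
  smooth (tensor u v).
Proof.
move=> su sv s; have [u' [v' [su' sv' ->]]] := partials_tensor s su sv; split.
  by apply: continuous_tensor; exact: flat_generated_continuous.
move=> i [x y].
have [->|->] := ord2P i.
  have [w _ dw] := flat_generated_is_derive su'.
  by have [] := is_derive_tensor1 v' y (dw x).
have [w _ dw] := flat_generated_is_derive sv'.
by have [] := is_derive_tensor2 u' x (dw y).
Qed.

Lemma test_tensor u v B : flat_generated u -> flat_generated v ->
  (forall x, x \notin `[- B, B] -> u x = 0) ->
  (forall x, x \notin `[- B, B] -> v x = 0) ->
  exists2 f : testfun R, testfun_val f = tensor u v &
    forall x y, tsupport f (x, y) -> (x \in `[- B, B]) && (y \in `[- B, B]).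
Proof.
move=> su sv u0 v0.
have cS : compact (`[- B, B] `*` `[- B, B] : set (R * R)).
  by apply: compact_setX; exact: segment_compact.
have hS : tsupport (tensor u v) `<=` `[- B, B] `*` `[- B, B].
  have cl : closed (`[- B, B] `*` `[- B, B] : set (R * R)).
    by apply: compact_closed => //; exact: norm_hausdorff.
  rewrite ((closure_id _).1 cl); apply: closureS => -[x y] /= h.
  split => /=; apply: contraNT h => h; rewrite /tensor/=.
    by rewrite (u0 _ h) mul0r.
  by rewrite (v0 _ h) mulr0.
have tP : tensor u v \in test_pred.
  rewrite inE; split; first exact: smooth_tensor.
  by apply: (subclosed_compact _ cS hS); exact: closed_closure.
by exists (TestFun tP) => // x y /hS[/= -> ->].
Qed.

End tensor.

(** * Recovering a function from its distributional derivative *)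

Section localization.
Context {R : realType}.
Local Notation mu := (@lebesgue_measure R).
Implicit Types (g : R * R -> R) (a b c d e B : R).

(** The square is large and common to several base points, so that averages at
    different points can be added; [averageE] shrinks it to the square of side e
    on which the integrand lives. *)
Definition average e g a c B : R :=
  rect_int (- B) B (- B) B (fun p => g p * tensor (pulse e a) (pulse e c) p).

Lemma pulse_outside e a B (x : R) : 0 < e -> - B <= a -> a + e <= B ->
  x \notin `[- B, B] -> pulse e a x = 0.
Proof.
move=> e0 aB1 aB2 xB; apply: pulse_eq0 => //; apply: contra xB.
by rewrite !in_itv/= => /andP[x1 x2]; rewrite (le_trans aB1)//= (le_trans x2).
Qed.

Lemma averageE e g a c B : 0 < e ->
  - B <= a -> a + e <= B -> - B <= c -> c + e <= B ->
  average e g a c B =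
  rect_int a (a + e) c (c + e)
    (fun p => g p * tensor (pulse e a) (pulse e c) p).
Proof.
move=> e0 aB1 aB2 cB1 cB2; rewrite /average -!rect_intE// => x y.
  by move=> /orP[h|h]; rewrite /tensor/= (pulse_eq0 e0 h) ?mulr0 ?mul0r ?mulr0.
rewrite /tensor/= => /orP[h|h].
  by rewrite (pulse_outside e0 aB1 aB2 h) mul0r mulr0.
by rewrite (pulse_outside e0 cB1 cB2 h) !mulr0.
Qed.

Lemma ramp_difference_outside e a b B (x : R) : 0 < e ->
  - B <= a -> a + e <= B -> - B <= b -> b + e <= B ->
  x \notin `[- B, B] -> ramp e a x + (- 1) * ramp e b x = 0.
Proof.
move=> e0 a1 a2 b1 b2; rewrite in_itv/= negb_and -!ltNge => /orP[xB|xB].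
  have xB' := ltW xB.
  by rewrite !ramp_le ?mulr0 ?addr0// (le_trans xB').
have xB' := ltW xB.
by rewrite !ramp_ge ?mulr1 ?subrr// (le_trans _ xB').
Qed.

Lemma continuous_average_integrand e g a c : continuous g ->
  continuous (fun p => g p * tensor (pulse e a) (pulse e c) p).
Proof.
move=> cg p; apply: cvgM; first exact: cg.
by apply: continuous_tensor; exact: continuous_pulse.
Qed.

Lemma average_cst e k a c B : 0 < e ->
  - B <= a -> a + e <= B -> - B <= c -> c + e <= B ->
  average e (cst k) a c B = k.
Proof.
move=> e0 aB1 aB2 cB1 cB2; rewrite averageE// /rect_int.
transitivity (\int[mu]_(x in `[a, a + e]) (k * pulse e a x)).
  apply: eq_Rintegral => x _.
  under eq_Rintegral do rewrite /tensor/= mulrA.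
  rewrite RintegralZl//; last by apply: integrable_segment;
    exact: continuous_pulse.
  by rewrite Rintegral_pulse// mulr1.
rewrite RintegralZl//; last by apply: integrable_segment;
  exact: continuous_pulse.
by rewrite Rintegral_pulse// mulr1.
Qed.

(** Since [average] reproduces constants, only g - g(a,c) has to be averaged. It
    is small on the square of side e, while the two pulses are O(1/e) each and
    the area is e ^ 2. *)
Lemma average_near g a c r : continuous g -> 0 < r ->
  exists2 e0, 0 < e0 & forall e B, 0 < e -> e < e0 ->
  - B <= a -> a + e <= B -> - B <= c -> c + e <= B ->
  `|average e g a c B - g (a, c)| <= r.
Proof.
move=> cg r0.
have [M M0 hM] := @derive1_step_bounded R.
have M1 : 0 < M * M + 1 by nra.
have : \forall p \near (a, c), `|g (a, c) - g p| <= r / (M * M + 1).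
  by move/cvgrPdist_le : (cg (a, c)); apply; exact: divr_gt0.
move=> /nbhs_ballP[e0 /= e00 he0]; exists e0 => // e B e0' ee0 aB1 aB2 cB1 cB2.
have ce := @continuous_average_integrand e _ a c cg.
rewrite -[X in _ - X](average_cst (g (a, c)) e0' aB1 aB2 cB1 cB2) !averageE//.
have -> : forall u v : R, u - v = - 1 * v + u by move=> *; ring.
rewrite -rect_int_lin//; last exact/continuous_average_integrand/cst_continuous.
apply: (@le_trans _ _ (r / (M * M + 1) * ((e^-1 * M) * (e^-1 * M)) *
    (c + e - c) * (a + e - a))).
  apply: rect_int_bound; rewrite ?lerDl ?(ltW e0')//.
    move=> p; apply: cvgD; last exact: ce.
    by apply: cvgMl_tmp; exact/continuous_average_integrand/cst_continuous.
  move=> x y xa yc.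
  have -> :
    - 1 * (cst (g (a, c)) (x, y) * tensor (pulse e a) (pulse e c) (x, y)) +
    g (x, y) * tensor (pulse e a) (pulse e c) (x, y) =
    (g (x, y) - g (a, c)) * (pulse e a x * pulse e c y).
    by rewrite /tensor/=; ring.
  rewrite normrM; apply: ler_pM => //.
    rewrite distrC; apply: he0; split => /=; rewrite /ball/= distrC ger0_norm.
    - by move: xa; rewrite in_itv/=; lra.
    - by move: xa; rewrite in_itv/=; lra.
    - by move: yc; rewrite in_itv/=; lra.
    - by move: yc; rewrite in_itv/=; lra.
  have pM t z : `|pulse e t z| <= e^-1 * M.
    by rewrite /pulse normrM gtr0_norm ?invr_gt0// ler_pM2l ?invr_gt0//.
  by rewrite normrM; apply: ler_pM.
have -> : r / (M * M + 1) * (e^-1 * M * (e^-1 * M)) *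
    (c + e - c) * (a + e - a) = (M * M) / (M * M + 1) * r.
  by field; rewrite gt_eqF// gt_eqF.
by rewrite ler_piMl ?(ltW r0)// ler_pdivrMr// mul1r lerDl.
Qed.

Lemma common_square a b c d e : 0 < e ->
  exists B, forall t, t \in [:: a; b; c; d] -> - B <= t /\ t + e <= B.
Proof.
move=> e0; exists (`|a| + `|b| + `|c| + `|d| + e) => t.
have na := normr_ge0 a; have nb := normr_ge0 b.
have nc := normr_ge0 c; have nd := normr_ge0 d.
have h1 := ler_norm t; have h2 := ler_norm (- t); rewrite normrN in h2.
by rewrite !inE => /or4P[] /eqP E; rewrite E in h1 h2 *; split; lra.
Qed.

(** The signed sum of the averages is 0, so the mixed difference is at most the
    sum of the four errors. *)
Lemma mixed_error (A1 A2 A3 A4 g1 g2 g3 g4 r : R) :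
  `|A1 - g1| <= r / 4 -> `|A2 - g2| <= r / 4 -> `|A3 - g3| <= r / 4 ->
  `|A4 - g4| <= r / 4 -> - 1 * A2 + (- 1 * A3 + (1 * A4 + A1)) = 0 ->
  `|g1 - g2 - g3 + g4| <= r.
Proof.
rewrite !ler_norml => /andP[? ?] /andP[? ?] /andP[? ?] /andP[? ?] ?.
by apply/andP; split; lra.
Qed.

(** The test function is alpha(x) beta(y) with alpha = ramp a - ramp b and beta
    = ramp c - ramp d; its mixed derivative is a signed sum of four products of
    pulses, so d12 F evaluates to the signed sum of four averages of F. *)
Lemma d12_eq0_mixed_difference (F : \bar R * \bar R -> R) a b c d :
  continuous F -> d12 F = 0 ->
  F (a%:E, c%:E) - F (b%:E, c%:E) - F (a%:E, d%:E) + F (b%:E, d%:E) = 0.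
Proof.
move=> cF F0; pose g := finite_part F.
have cg : continuous g by exact: continuous_finite_part.
rewrite -[LHS]/(g (a, c) - g (b, c) - g (a, d) + g (b, d)).
apply/eqP; rewrite -normr_le0; apply/ler_addgt0Pl => r r0; rewrite addr0.
have r4 : 0 < r / 4 by rewrite divr_gt0.
have [e1 e10 h1] := average_near a c cg r4.
have [e2 e20 h2] := average_near b c cg r4.
have [e3 e30 h3] := average_near a d cg r4.
have [e4 e40 h4] := average_near b d cg r4.
have [e [e0 ee1 ee2 ee3 ee4]] :
  exists e, [/\ 0 < e, e < e1, e < e2, e < e3 & e < e4].
  (* half of the minimum, the inequalities being strict *)
  pose m := Num.min (Num.min e1 e2) (Num.min e3 e4).
  have m0 : 0 < m by rewrite !lt_min e10 e20 e30 e40.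
  have mm : m / 2 < m by rewrite gtr_pMr// invf_lt1// ltr1n.
  exists (m / 2); split; [by rewrite divr_gt0|..]; apply: (lt_le_trans mm);
    by rewrite !ge_min lexx ?orbT.
have [B hB] := common_square a b c d e0.
have [aB1 aB2] := hB a ltac:(by rewrite !inE eqxx).
have [bB1 bB2] := hB b ltac:(by rewrite !inE eqxx ?orbT).
have [cB1 cB2] := hB c ltac:(by rewrite !inE eqxx ?orbT).
have [dB1 dB2] := hB d ltac:(by rewrite !inE eqxx ?orbT).
(* Both ramps are 1 to the right of the square, so their difference has
   compact support. *)
pose u t1 t2 x := ramp e t1 x + (- 1) * ramp e t2 x.
have su t1 t2 : flat_generated (u t1 t2).
  apply: fg_add; first exact: flat_generated_ramp.
  by apply: (@fg_mul _ (fun=> - 1)); [exact: fg_cst|exact: flat_generated_ramp].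
have du t1 t2 (x : R) : is_derive x 1 (u t1 t2) (pulse e t1 x - pulse e t2 x).
  have := is_deriveD (is_derive_ramp e t1 x)
    (is_deriveZ (- 1) (is_derive_ramp e t2 x)).
  by move=> /is_derive_eq; apply; rewrite scaleN1r.
have uab := fun x => @ramp_difference_outside e a b B x e0 aB1 aB2 bB1 bB2.
have ucd := fun x => @ramp_difference_outside e c d B x e0 cB1 cB2 dB1 dB2.
have [f fE fB] := test_tensor (su a b) (su c d) uab ucd.
pose k t1 t2 p := g p * tensor (pulse e t1) (pulse e t2) p.
have kE : d12_kernel F f = fun p =>
    (-1) * k b c p + ((-1) * k a d p + (1 * k b d p + k a c p)).
  apply/funext => p; rewrite /d12_kernel fE /=.
  rewrite (partial_tensor2 _ (du c d)) (partial_tensor1 _ (du a b)) /k /tensor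
    -/g /=.
  move: (pulse e a p.1) (pulse e b p.1) (pulse e c p.2) (pulse e d p.2) (g p).
  by move=> *; ring.
have ck t1 t2 : continuous (k t1 t2) by exact: continuous_average_integrand.
have cl l (k1 k2 : R * R -> R) : continuous k1 -> continuous k2 ->
    continuous (fun p => l * k1 p + k2 p).
  by move=> c1 c2 p; apply: cvgD; [apply: cvgMl_tmp; exact: c1|exact: c2].
have : d12 F f = 0 by rewrite F0.
rewrite (d12E _ fB) kE.
rewrite rect_int_lin;
  [|exact: ck|exact: (cl _ _ _ (ck _ _) (cl _ _ _ (ck _ _) (ck _ _)))].
rewrite rect_int_lin; [|exact: ck|exact: (cl _ _ _ (ck _ _) (ck _ _))].
rewrite rect_int_lin; [|exact: ck|exact: ck].
apply: mixed_error; [exact: h1 e B e0 ee1 aB1 aB2 cB1 cB2|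
  exact: h2 e B e0 ee2 bB1 bB2 cB1 cB2|exact: h3 e B e0 ee3 aB1 aB2 dB1 dB2|
  exact: h4 e B e0 ee4 bB1 bB2 dB1 dB2].
Qed.

Lemma continuous_barNy (h : \bar R -> R) : continuous h ->
  h x%:E @[x --> -oo] --> h -oo%E.
Proof.
have EFinNy : x%:E @[x --> -oo] --> (-oo%E : \bar R).
  by apply/cvgerNyP; exact: cvg_id.
by move=> ch; apply: (cvg_comp _ _ EFinNy); exact: ch.
Qed.

Lemma continuous_bary (h : \bar R -> R) : continuous h ->
  h x%:E @[x --> +oo] --> h +oo%E.
Proof.
have EFiny : x%:E @[x --> +oo] --> (+oo%E : \bar R).
  by apply/cvgeryP; exact: cvg_id.
by move=> ch; apply: (cvg_comp _ _ EFiny); exact: ch.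
Qed.

Lemma continuous_bar_eq0 (h : \bar R -> R) : continuous h ->
  (forall x : R, h x%:E = 0) -> forall x, h x = 0.
Proof.
move=> ch h0 [x|| ]; first exact: h0.
  have := continuous_bary ch; under eq_fun do rewrite h0.
  by move=> /(cvg_unique _ (cvg_cst 0)) => <-//; exact: norm_hausdorff.
have := continuous_barNy ch; under eq_fun do rewrite h0.
by move=> /(cvg_unique _ (cvg_cst 0)) => <-//; exact: norm_hausdorff.
Qed.

Lemma continuous_bar_slice1 (F : \bar R * \bar R -> R) x :
  continuous F -> continuous (fun y => F (x, y)).
Proof.
move=> cF y; apply: (@continuous_comp _ _ _ (fun y => (x, y)) F);
  last exact: cF.
exact: (cvg_pair (cvg_cst x) cvg_id).
Qed.

Lemma continuous_bar_slice2 (F : \bar R * \bar R -> R) y :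
  continuous F -> continuous (fun x => F (x, y)).
Proof.
move=> cF x; apply: (@continuous_comp _ _ _ (fun x => (x, y)) F);
  last exact: cF.
exact: (cvg_pair cvg_id (cvg_cst y)).
Qed.

(** The mixed difference identity says that F(b,c) - F(b,d) is constant in b;
    letting b tend to -oo, the constant is 0, so F(a,c) does not depend on c,
    and letting c tend to -oo it is 0. *)
Lemma d12_eq0 (F : \bar R * \bar R -> R) : Bc F -> d12 F = 0 -> F = 0.
Proof.
move=> [cF Fb] F0.
have mixed := fun a b c d => @d12_eq0_mixed_difference F a b c d cF F0.
have lim1 c : F (b%:E, c%:E) @[b --> -oo] --> (0 : R).
  have := continuous_barNy (@continuous_bar_slice2 F c%:E cF).
  by rewrite (Fb c%:E).1.
have lim2 a : F (a%:E, d%:E) @[d --> -oo] --> (0 : R).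
  have := continuous_barNy (@continuous_bar_slice1 F a%:E cF).
  by rewrite (Fb a%:E).2.
have hd a c d : F (a%:E, c%:E) = F (a%:E, d%:E).
  have : F (b%:E, c%:E) - F (b%:E, d%:E) @[b --> -oo] --> (0 - 0 : R).
    by apply: cvgB; exact: lim1.
  have -> : (fun b => F (b%:E, c%:E) - F (b%:E, d%:E)) =
      cst (F (a%:E, c%:E) - F (a%:E, d%:E)).
    by apply/funext => b /=; have := mixed a b c d; lra.
  move=> /(cvg_unique _ (cvg_cst _)); rewrite subr0 => h.
  by apply/eqP; rewrite -subr_eq0; apply/eqP/h; exact: norm_hausdorff.
have h0 a c : F (a%:E, c%:E) = 0.
  have := lim2 a; under eq_fun do rewrite -(hd a c).
  by move=> /(cvg_unique _ (cvg_cst _)) -> //; exact: norm_hausdorff.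
apply/funext => -[x y].
apply: (continuous_bar_eq0 (@continuous_bar_slice1 F x cF)) => {}y.
apply: (continuous_bar_eq0 (@continuous_bar_slice2 F y%:E cF)) => {}x.
exact: h0.
Qed.

End localization.

(** * The Banach space of primitives *)

Section extended_plane.
Context {R : realType}.
Implicit Types (F G : \bar R * \bar R -> R).

(** The metric of the extended line is the pullback of that of [-1, 1] under
    [contract], so [expand] is an isometry from this segment onto the extended
    line. *)
Lemma compact_ereal : compact [set: \bar R].
Proof.
have -> : [set: \bar R] = @expand R @` `[-1, 1].
  apply/seteqP; split=> // x _; exists (contract x); last exact: contractK.
  by rewrite /= in_itv/= -ler_norml contract_le1.
apply: continuous_compact; last exact: segment_compact.
apply/subspace_continuousP => x /= x1.
apply/cvg_ballP => e e0.
near=> y.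
have y1 : y \in `[-1, 1] by near: y; exact: withinT.
rewrite /ball/= /ereal_ball !expandK; last 2 first.
- by move: y1; rewrite in_itv/= inE ler_norml.
- by move: x1; rewrite in_itv/= inE ler_norml.
near: y; apply: cvg_within.
by move/cvgrPdist_lt : (@cvg_id _ (nbhs x)); apply.
Unshelve. all: end_near. Qed.

Lemma unorm_ub F p : continuous F -> `|F p| <= unorm F.
Proof.
move=> cF; apply: sup_ubound; last by exists p.
have cT : compact [set: \bar R * \bar R].
  by rewrite -setXTT; apply: compact_setX; exact: compact_ereal.
have /compact_bounded[M [_ hM]] : compact (F @` [set: \bar R * \bar R]).
  by apply: continuous_compact => //; exact: continuous_subspaceT.
exists (`|M| + 1) => _ [q _ <-].
by apply: hM; [rewrite (le_lt_trans (ler_norm M))// ltrDl|exists q].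
Qed.

Lemma unorm_le F M : (forall p, `|F p| <= M) -> unorm F <= M.
Proof.
move=> FM; apply: ge_sup; first by exists `|F (0, 0)%E|, (0, 0)%E.
by move=> _ [p _ <-].
Qed.

Lemma Bc_submod_closed : GRing.submod_closed (mem (@Bc R)).
Proof.
split=> [|a F G]; rewrite !inE.
  by split=> // p; exact: cst_continuous.
move=> [cF F0] [cG G0]; split=> [p|s].
  apply: (@continuousD _ _ _ (a *: F)); last exact: cG.
  by apply: continuousZl_tmp; exact: cF.
have [f1 f2] := F0 s; have [g1 g2] := G0 s.
by rewrite !addrfctE !scalrfctE f1 f2 g1 g2 scaler0 addr0.
Qed.

Definition Bc_pred : {pred \bar R * \bar R -> R} := mem (@Bc R).

HB.instance Definition _ :=
  GRing.isSubmodClosed.Build R (\bar R * \bar R -> R) Bc_pred Bc_submod_closed.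

End extended_plane.

(** [Bc] as a type, the carrier of the normed module structure. *)
Record bc_fun (R : realType) := BcFun {
  bc_val :> \bar R * \bar R -> R;
  bc_valP : bc_val \in Bc_pred }.

HB.instance Definition _ (R : realType) := [isSub for @bc_val R].
HB.instance Definition _ (R : realType) := [Choice of bc_fun R by <:].
HB.instance Definition _ (R : realType) :=
  [SubChoice_isSubLmodule of bc_fun R by <:].

Section bc_norm.
Context {R : realType}.
Implicit Types F G : bc_fun R.

Lemma bc_continuous F : continuous F.
Proof. by case: F => F /=; rewrite inE => -[]. Qed.

Lemma bc_unormD F G : unorm (F + G : bc_fun R) <= unorm F + unorm G.
Proof.
apply: unorm_le => p; apply: (le_trans (ler_normD _ _)).
by apply: lerD; apply: unorm_ub; exact: bc_continuous.
Qed.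

Lemma bc_unormZ (a : R) F : unorm (a *: F : bc_fun R) = `|a| * unorm F.
Proof.
have le k G : unorm (k *: G : bc_fun R) <= `|k| * unorm G.
  apply: unorm_le => p; rewrite [leLHS]normrM ler_wpM2l//.
  by apply: unorm_ub; exact: bc_continuous.
apply/eqP; rewrite eq_le; apply/andP; split; first exact: le.
have [->|a0] := eqVneq a 0.
  rewrite normr0 mul0r.
  by apply: (le_trans (normr_ge0 _)); apply: (@unorm_ub _ _ (0, 0)%E);
    exact: bc_continuous.
have := le a^-1 (a *: F); rewrite scalerA mulVf// scale1r.
by rewrite normfV -ler_pdivrMl ?invr_gt0 ?normr_gt0// invrK.
Qed.

Lemma bc_unorm0_eq0 F : unorm F = 0 -> F = 0.
Proof.
move=> F0; apply: val_inj; apply/funext => p /=.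
by apply/eqP; rewrite -normr_le0 -F0; apply: unorm_ub; exact: bc_continuous.
Qed.

HB.instance Definition _ := @Lmodule_isNormed.Build R (bc_fun R)
  (fun F => unorm F) bc_unormD bc_unormZ bc_unorm0_eq0.

Lemma bc_le_norm F p : `|F p| <= `|F|.
Proof. by apply: unorm_ub; exact: bc_continuous. Qed.

(** The pointwise limit L is a uniform limit by the Cauchy property; hence it is
    continuous, and it inherits the boundary conditions. *)
Lemma bc_cauchy_cvg (FF : set_system (bc_fun R)) {PF : ProperFilter FF} :
  cauchy FF -> cvg FF.
Proof.
move=> /cauchy_ballP FC.
have cp p : cvg ((fun F : bc_fun R => F p) @ FF).
  apply: cauchy_cvg; apply/cauchy_ballP => e e0.
  rewrite near_map2; apply: filterS (FC e e0) => -[F G] /= FG.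
  by apply: le_lt_trans FG; exact: (bc_le_norm (F - G) p).
pose L p := lim ((fun F : bc_fun R => F p) @ FF).
have LU (e : R) : 0 < e ->
    \forall F \near FF, forall p, `|L p - (F : bc_fun R) p| <= e.
  move=> e0; near=> F => p; near FF => G.
  rewrite (splitr e) (le_trans (ler_distD (G p) _ _))// lerD//.
    near: G; move/cvgrPdist_le : (cp p); apply; exact: divr_gt0.
  apply: (le_trans (bc_le_norm (G - F) p)); apply: ltW.
  rewrite distrC; near: G; near: F; apply: nearP_dep; apply: FC.
  exact: divr_gt0.
have cL : continuous L.
  move=> x; apply/cvgrPdist_le => e e0; near FF => F; near=> y.
  have Fe p : `|L p - F p| <= e / 3.
    by move: p; near: F; apply: LU; exact: divr_gt0.
  have Fxy : `|F x - F y| <= e / 3.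
    near: y; move/cvgrPdist_le : (@bc_continuous F x); apply; exact: divr_gt0.
  have -> : L x - L y = (L x - F x) + (F x - F y) - (L y - F y) by ring.
  rewrite (le_trans (ler_normB _ _))// (_ : e = e / 3 + e / 3 + e / 3);
    last by field.
  by rewrite lerD// (le_trans (ler_normD _ _))// lerD.
have L0 p : (forall F : bc_fun R, F p = 0) -> L p = 0.
  by move=> p0; rewrite /L; under eq_fun do rewrite p0; exact: lim_cst.
have LB : L \in Bc_pred.
  rewrite inE; split=> // s; split; apply: L0 => -[F FP] /=;
  by move: FP; rewrite inE => -[_ /(_ s)[]].
apply/cvg_ex; exists (BcFun LB); apply/cvgrPdist_le => e e0.
apply: filterS (LU e e0) => F Fe; exact: unorm_le.
Unshelve. all: end_near. Qed.

HB.instance Definition _ := Uniform_isComplete.Build (bc_fun R) bc_cauchy_cvg.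

End bc_norm.

(** * Primitives *)

Section primitives.
Context {R : realType}.
Implicit Types (F G : \bar R * \bar R -> R).

Lemma d12_inj F G : Bc F -> Bc G -> d12 F = d12 G -> F = G.
Proof.
move=> BF BG FG; apply/eqP; rewrite -subr_eq0; apply/eqP.
have E : F - G = -1 *: G + F by rewrite scaleN1r addrC.
apply: d12_eq0.
  move: BF BG => /mem_set BF /mem_set BG; apply: set_mem; rewrite E.
  exact: (Bc_submod_closed.2 (-1) _ _ BG BF).
by rewrite E d12_linear ?FG ?scaleN1r ?addNr//; [exact: BG.1|exact: BF.1].
Qed.

Lemma primitive_d12 F : Bc F -> primitive (d12 F) = F.
Proof.
move=> BF; have FP : is_primitive (d12 F) F by split.
have [BP /esym] := xgetI 0 (P := [set G | is_primitive (d12 F) G]) FP.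
exact: d12_inj.
Qed.

(** The primitive is G(x,y) - G(-oo,y) - G(x,-oo) + G(-oo,-oo), grouped as G
    minus a function of y alone and a function of x alone. *)
Lemma Ac_d12 G : continuous G -> Ac (d12 G).
Proof.
move=> cG.
(* The constant G(-oo,-oo) is put into the function of x. *)
pose h2 x := G (x, -oo%E) - G (-oo%E, -oo%E).
have ch1 : continuous (fun y => G (-oo%E, y)) by exact: continuous_bar_slice1.
have ch2 : continuous h2.
  move=> x; apply: (@continuousB _ _ _ (fun x => G (x, -oo%E)));
    last exact: cst_continuous.
  exact: (@continuous_bar_slice2 R G -oo%E cG).
pose F1 (p : \bar R * \bar R) := G (-oo%E, p.2).
pose F2 (p : \bar R * \bar R) := h2 p.1.
have cF1 : continuous F1.
  by move=> p; apply: (@continuous_comp _ _ _ snd (fun y => G (-oo%E, y)));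
    [exact: cvg_snd|exact: ch1].
have cF2 : continuous F2.
  by move=> p; apply: (@continuous_comp _ _ _ fst h2);
    [exact: cvg_fst|exact: ch2].
have clin H : continuous H -> forall F, continuous F ->
    continuous (-1 *: F + H).
  move=> cH F cF p; apply: (@continuousD _ _ _ (-1 *: F)); last exact: cH.
  by apply: continuousZl_tmp; exact: cF.
split; first exact: d12_distribution.
exists (-1 *: F1 + (-1 *: F2 + G)); split; last first.
  rewrite !d12_linear//; last exact: clin.
  by rewrite (d12_snd ch1) (d12_fst ch2) !scaler0 !add0r.
split=> [|s]; first exact/clin/cF1/clin.
rewrite !addrfctE !scalrfctE /F1 /F2 /h2 /GRing.scale/=; split; ring.
Qed.

Definition bc_d12 (F : bc_fun R) : testfun R -> R := d12 F.

Lemma bc_d12_linear : linear bc_d12.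
Proof.
move=> a F G.
exact: (@d12_linear R F G a (@bc_continuous R F) (@bc_continuous R G)).
Qed.

HB.instance Definition _ :=
  GRing.isLinear.Build R (bc_fun R) (testfun R -> R) _ bc_d12 bc_d12_linear.

End primitives.

Theorem proposition4p2 (R : realType) :
  [/\ (* (a) *)
      forall f : testfun R -> R, Ac f -> exists! F, Bc F /\ f = d12 F,
      (* (b) *)
      [/\ banach_subspace (@Ac R) (@alexiewicz R),
          linear_on (@Bc R) (@d12 R),
          set_bij (@Bc R) (@Ac R) (@d12 R) &
          forall F : \bar R * \bar R -> R, Bc F -> alexiewicz (d12 F) = unorm F],
      (* (c) *)
      forall G : \bar R * \bar R -> R, continuous G -> Ac (d12 G) &
      (* (d) *)
      forall (f g : testfun R -> R) (c1 c2 : R) (phi : testfun R), Ac f -> Ac g ->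
        (c1 *: f + c2 *: g) phi = c1 * f phi + c2 * g phi ].
Proof.
have isometry (F : \bar R * \bar R -> R) : Bc F -> alexiewicz (d12 F) = unorm F.
  by move=> BF; rewrite /alexiewicz primitive_d12.
split=> //; last exact: Ac_d12.
- move=> f [_ [F [BF ->]]]; exists F; split=> // G [BG]; exact: d12_inj.
- split=> //.
  + exists (bc_fun R), bc_d12; split; last first.
      by move=> F; apply: isometry; apply: set_mem; exact: bc_valP.
    split=> [F _|F G _ _ /d12_inj FG|f [_ [F [BF ->]]]].
    * exact/Ac_d12/bc_continuous.
    * by apply/val_inj/FG; apply: set_mem; exact: bc_valP.
    * by exists (BcFun (mem_set BF)).
  + by move=> a F G BF BG; apply: d12_linear; [exact: BF.1|exact: BG.1].
  + split=> [F BF|F G /set_mem BF /set_mem BG|f [_ [F [BF ->]]]].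
    * exact: Ac_d12 BF.1.
    * exact: d12_inj.
    * by exists F.
Qed.
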